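(* The relation $\leq_{OT}$ is an admissible order on $\mathfrak{T}(\mathbb{R})$ with respect to $\leq_N$; that is, $\leq_{OT}$ is a linear (total) order on $\mathfrak{T}(\mathbb{R})$, and for all $A,B\in\mathfrak{T}(\mathbb{R})$, $A\leq_N B$ implies $A\leq_{OT}B$.
   Context: A triangular fuzzy number (TFN) is the function $A:\mathbb{R}\to[0,1]$ determined by a triple $(a,b,c)\in\mathbb{R}^3$ with $a\leq b\leq c$, with $A(b)=1$, $A(x)=\frac{x-a}{b-a}$ for $x\in\,]a,b[$, $A(x)=\frac{c-x}{c-b}$ for $x\in\,]b,c[$, and $A(x)=0$ otherwise. TFNs are identified with their triples $(a,b,c)$, and $\mathfrak{T}(\mathbb{R})$ denotes the set of all TFNs. For TFNs, $(a_1,b_1,c_1)\leq_N(a_2,b_2,c_2)$ if and only if $a_1\leq a_2$, $b_1\leq b_2$ and $c_1\leq c_2$. $(a_1,b_1,c_1)\leq_{OT}(a_2,b_2,c_2)$ if and only if $b_1<b_2$; or $b_1=b_2$ and $c_1<c_2$; or $b_1=b_2$, $c_1=c_2$ and $a_1\leq a_2$. An order $\preceq$ on $\mathfrak{T}(\mathbb{R})$ is called admissible with respect to $\leq_N$ if (i) $\preceq$ is a linear order on $\mathfrak{T}(\mathbb{R})$, and (ii) for all $A,B\in\mathfrak{T}(\mathbb{R})$, $A\preceq B$ whenever $A\leq_N B$. *)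

(* Defs.v *)
From HB Require Import structures.
From mathcomp Require Import all_boot all_order all_algebra.
From mathcomp Require Import reals.
From mathcomp Require Import lra.
Set Implicit Arguments.
Unset Strict Implicit.
Unset Printing Implicit Defensive.
Import Order.TTheory GRing.Theory Num.Theory.
Local Open Scope ring_scope.

(* Triangular fuzzy numbers are identified with their triples: [tfn_fun_inj]
   shows that a triple is determined by its membership function. *)
Record tfn (R : realType) := TFN {
  tfn_a : R;
  tfn_b : R;
  tfn_c : R;
  tfn_ab : tfn_a <= tfn_b;
  tfn_bc : tfn_b <= tfn_c }.

Definition tfn_fun (R : realType) (A : tfn R) (x : R) : R :=
  if x == tfn_b A then 1
  else if (tfn_a A < x) && (x < tfn_b A) then
    (x - tfn_a A) / (tfn_b A - tfn_a A)
  else if (tfn_b A < x) && (x < tfn_c A) then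
    (tfn_c A - x) / (tfn_c A - tfn_b A)
  else 0.

Definition tfn_leN (R : realType) : rel (tfn R) := fun A B =>
  [&& tfn_a A <= tfn_a B, tfn_b A <= tfn_b B & tfn_c A <= tfn_c B].

Definition tfn_leOT (R : realType) : rel (tfn R) := fun A B =>
  [|| tfn_b A < tfn_b B,
      (tfn_b A == tfn_b B) && (tfn_c A < tfn_c B)
    | [&& tfn_b A == tfn_b B, tfn_c A == tfn_c B & tfn_a A <= tfn_a B]].

Definition linear_order (T : Type) (le : rel T) : Prop :=
  [/\ reflexive le, antisymmetric le, transitive le & total le].

Definition admissible (T : Type) (le0 le : rel T) : Prop :=
  linear_order le /\ (forall A B : T, le0 A B -> le A B).

Lemma tfn_eq (R : realType) (A B : tfn R) :
  tfn_a A = tfn_a B -> tfn_b A = tfn_b B -> tfn_c A = tfn_c B -> A = B.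
Proof.
case: A B => [a b c ab bc] [a' b' c' ab' bc'] /= ea eb ec.
by subst; rewrite (bool_irrelevance ab ab') (bool_irrelevance bc bc').
Qed.

Lemma tfn_fun_itv (R : realType) (A : tfn R) (x : R) : 0 <= tfn_fun A x <= 1.
Proof.
rewrite /tfn_fun; case: eqP => _; first by rewrite ler01 lexx.
case: ifP => [/andP[h1 h2]|_].
  have d : 0 < tfn_b A - tfn_a A by lra.
  by rewrite ler_pdivrMr // divr_ge0 ?(ltW d) //=; lra.
case: ifP => [/andP[h1 h2]|_]; last by rewrite lexx ler01.
have d : 0 < tfn_c A - tfn_b A by lra.
by rewrite ler_pdivrMr // divr_ge0 ?(ltW d) //=; lra.
Qed.

Lemma tfn_fun_eq1 (R : realType) (A : tfn R) (x : R) :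
  tfn_fun A x = 1 -> x = tfn_b A.
Proof.
rewrite /tfn_fun; case: eqP => // _.
case: ifP => [/andP[h1 h2] /eqP|_].
  have d : tfn_b A - tfn_a A != 0 by apply/eqP; lra.
  by rewrite -subr_eq0 -(divff d) -mulrBl mulf_eq0 invr_eq0 (negPf d) orbF => /eqP; lra.
case: ifP => [/andP[h1 h2] /eqP|_ /eqP]; last by rewrite eq_sym oner_eq0.
have d : tfn_c A - tfn_b A != 0 by apply/eqP; lra.
by rewrite -subr_eq0 -(divff d) -mulrBl mulf_eq0 invr_eq0 (negPf d) orbF => /eqP; lra.
Qed.

Lemma tfn_fun_gt0 (R : realType) (A : tfn R) (x : R) :
  (0 < tfn_fun A x) = (x == tfn_b A) || (tfn_a A < x < tfn_c A).
Proof.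
have [ab bc] := (tfn_ab A, tfn_bc A).
rewrite /tfn_fun; case: (ltgtP x (tfn_b A)) => h /=; last exact: ltr01.
- have -> : x < tfn_c A by lra.
  rewrite !andbT; case: ifP => [h1|_]; last by rewrite ltxx.
  by apply: divr_gt0; lra.
- have -> : tfn_a A < x by lra.
  rewrite andbF /=; case: ifP => [h1|_]; last by rewrite ltxx.
  by apply: divr_gt0; lra.
Qed.

Lemma tfn_fun_inj (R : realType) (A B : tfn R) : tfn_fun A =1 tfn_fun B -> A = B.
Proof.
move=> eAB.
have eb : tfn_b A = tfn_b B.
  by apply: tfn_fun_eq1; rewrite -eAB /tfn_fun eqxx.
have [Aab Abc Bab Bbc] := And4 (tfn_ab A) (tfn_bc A) (tfn_ab B) (tfn_bc B).
have S x : (x == tfn_b A) || (tfn_a A < x < tfn_c A)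
         = (x == tfn_b A) || (tfn_a B < x < tfn_c B).
  by rewrite {2}eb -!tfn_fun_gt0 eAB.
apply: tfn_eq => //.
- case: (ltgtP (tfn_a A) (tfn_a B)) => // h.
    have := S ((tfn_a A + tfn_a B) / 2%:R).
    rewrite (_ : _ == _ = false) /=; last by apply/eqP; lra.
    by case: (ltP (tfn_a B) _) => [|_]; [lra | move/negbT/negP => []; apply/andP; split; lra].
  have := S ((tfn_a A + tfn_a B) / 2%:R).
  rewrite (_ : _ == _ = false) /=; last by apply/eqP; lra.
  by case: (ltP (tfn_a A) _) => [|_ /esym/negbT/negP[]]; [lra | apply/andP; split; lra].
- case: (ltgtP (tfn_c A) (tfn_c B)) => // h.
    have := S ((tfn_c A + tfn_c B) / 2%:R).
    rewrite (_ : _ == _ = false) /=; last by apply/eqP; lra.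
    case: (ltP _ (tfn_c A)) => [|_]; first by lra.
    by rewrite andbF => /esym/negbT/negP[]; apply/andP; split; lra.
  have := S ((tfn_c A + tfn_c B) / 2%:R).
  rewrite (_ : _ == _ = false) /=; last by apply/eqP; lra.
  case: (ltP _ (tfn_c B)) => [|_]; first by lra.
  by rewrite andbF => /negbT/negP[]; apply/andP; split; lra.
Qed.

(* Main.v *)
(** [tfn_leOT] is the lexicographic order on the triples [(b, c, a)], pulled
    back along the injection [(a, b, c) |-> (b, c, a)]; a lexicographic order
    of total orders is total and refines the componentwise order. *)
Require Import Defs.
From mathcomp Require Import all_boot all_order all_algebra.
From mathcomp Require Import reals.

Set Implicit Arguments.
Unset Strict Implicit.
Unset Printing Implicit Defensive.
Import Order.TTheory.

(** The type [*l] carries the lexicographic order as its canonical order, so [<=] on keys is already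
    total. *)
Definition tfn_key (R : realType) (A : tfn R) : R *l (R *l R) :=
  (tfn_b A, (tfn_c A, tfn_a A)).

Lemma tfn_key_inj (R : realType) : injective (@tfn_key R).
Proof. by move=> A B [eb ec ea]; apply: tfn_eq. Qed.

Lemma tfn_leOT_key (R : realType) (A B : tfn R) :
  tfn_leOT A B = (tfn_key A <= tfn_key B)%O.
Proof.
rewrite /tfn_leOT !lexi_pair.
(* Trichotomy on [b], then on [c], turns both sides into the same constant or, when both tie, into
   the comparison of the [a]'s. *)
by case: (ltgtP (tfn_b A)) => //= _; case: (ltgtP (tfn_c A)).
Qed.

Lemma tfn_leN_leOT (R : realType) (A B : tfn R) : tfn_leN A B -> tfn_leOT A B.
Proof.
case/and3P=> lea leb lec.
(* [lexi_pair] guards each later comparison by a tie condition; here every guarded conclusion holds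
   outright. *)
by rewrite tfn_leOT_key !lexi_pair leb lec lea !implybT.
Qed.

Theorem proposition3p1 (R : realType) :
  admissible (@tfn_leN R) (@tfn_leOT R).
Proof.
split; last exact: tfn_leN_leOT.
split=> [A | A B | B A C | A B]; rewrite !tfn_leOT_key.
- exact: lexx.
(* Only antisymmetry needs the key to be injective. *)
- by move/le_anti/tfn_key_inj.
- exact: le_trans.
- exact: le_total.
Qed.
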